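(* Let $m\ge 3$ and $n\ge 2$ be integers. The grid graph $P_m\,\Box\,P_n$ (Cartesian product of the paths on $m$ and $n$ vertices) satisfies $md(P_m\,\Box\,P_n)=3$.
   Context: For vertices $u,v$ of a connected graph $G$, $d(u,v)$ is the length of a shortest $u$–$v$ path. For $W\subseteq V(G)$ and $v\in V(G)$, $r_m(v|W)$ is the multiset $\{d(v,w): w\in W\}$. $W$ is an m-resolving set if $r_m(u|W)\neq r_m(v|W)$ for all distinct $u,v\in V(G)$. If $G$ has an m-resolving set, $md(G)$ is the minimum cardinality of one; otherwise $md(G)=\infty$. *)

(* Defs.v *)
From mathcomp Require Import all_boot finmap multiset.

Set Implicit Arguments.
Unset Strict Implicit.
Unset Printing Implicit Defensive.

Record sgraph := SGraph {
  vertex :> finType;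
  adj : rel vertex;
  adj_sym : symmetric adj;
  adj_irr : irreflexive adj }.

Section PathGraph.
Variable n : nat.

Definition path_adj : rel 'I_n :=
  fun i j => (i.+1 == j :> nat) || (j.+1 == i :> nat).

Lemma path_adj_sym : symmetric path_adj.
Proof. by move=> i j; rewrite /path_adj orbC. Qed.

Lemma path_adj_irr : irreflexive path_adj.
Proof. by move=> i; rewrite /path_adj orbb gtn_eqF. Qed.

Definition path_graph : sgraph := SGraph path_adj_sym path_adj_irr.
End PathGraph.

Section CartesianProduct.
Variables G H : sgraph.

Definition cart_adj : rel (G * H) :=
  fun x y => ((x.1 == y.1) && adj x.2 y.2) || ((x.2 == y.2) && adj x.1 y.1).

Lemma cart_adj_sym : symmetric cart_adj.
Proof.
move=> x y; rewrite /cart_adj (eq_sym x.1) (eq_sym x.2).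
by rewrite (adj_sym x.1) (adj_sym x.2).
Qed.

Lemma cart_adj_irr : irreflexive cart_adj.
Proof. by move=> x; rewrite /cart_adj !adj_irr !andbF. Qed.

Definition cart_graph : sgraph := SGraph cart_adj_sym cart_adj_irr.
End CartesianProduct.

Section MultisetDimension.
Variable G : sgraph.

Definition walk_of_length (u v : G) (k : nat) : bool :=
  [exists p : k.-tuple G, path (@adj G) u p && (last u p == v)].

(* The search stops below #|G|, since a shortest path repeats no vertex.
   The value is #|G| when v cannot be reached from u, which does not occur
   in a connected graph. *)
Definition dist (u v : G) : nat := find (walk_of_length u v) (iota 0 #|G|).

Lemma dist_le u v p :
  path (@adj G) u p -> last u p = v -> dist u v <= size p.
Proof.
move=> up lp; have [lt|le] := ltnP (size p) #|G|.
  rewrite leqNgt; apply/negP => /(before_find 0).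
  rewrite nth_iota // add0n => /existsP; apply; exists (in_tuple p) => /=.
  by rewrite up lp eqxx.
by apply: leq_trans le; rewrite -[X in _ <= X](size_iota 0) find_size.
Qed.

Lemma dist_path u v : connect (@adj G) u v ->
  exists p, [/\ path (@adj G) u p, last u p = v & size p = dist u v].
Proof.
case/connectP => p0 /shortenP[p up uniqp _] ->.
have szp : size p < #|G|.
  by rewrite -[(size p).+1]/(size (u :: p)) -(card_uniqP uniqp) max_card.
have hasw : has (walk_of_length u (last u p)) (iota 0 #|G|).
  apply/hasP; exists (size p); first by rewrite mem_iota.
  by apply/existsP; exists (in_tuple p); rewrite /= up eqxx.
have := nth_find 0 hasw; rewrite nth_iota ?add0n; last first.
  by move: hasw; rewrite has_find size_iota.
by case/existsP=> q /andP[uq /eqP lq]; exists q; rewrite size_tuple.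
Qed.

Definition r_m (W : {set G}) (v : G) : {mset nat}%mset :=
  seq_mset [seq dist v w | w in W].

Definition m_resolving (W : {set G}) : bool :=
  [forall u, forall v, (u != v) ==> (r_m W u != r_m W v)].

(* None stands for infinity. *)
Definition md : option nat :=
  if [pick W | m_resolving W] is Some W0
  then Some #|[arg min_(W < W0 | m_resolving W) #|W|]|
  else None.
End MultisetDimension.

(* Main.v *)
Require Import Defs.
From mathcomp Require Import all_boot.
From mathcomp Require Import finmap multiset zify.

Set Implicit Arguments.
Unset Strict Implicit.
Unset Printing Implicit Defensive.

(** Distances in the grid are Manhattan distances. A set of at most two
    vertices never resolves: two vertices [w1], [w2] both see the multiset
    {0, d(w1, w2)}, and a single vertex has two neighbours, both at distance 1.
    Conversely, for [m >= 4] the vertices (0,0), (1,0), (m-1,0) resolve: up to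
    a shift by [y], the vertex (x,y) sees {x-1, x, m-1-x} if [x > 0] and
    {0, 1, m-1} if [x = 0], and the position of the third value relative to the
    two consecutive ones determines [x], with parity excluding the ambiguous
    case of three consecutive values. For [m = 3] that case does occur, and
    (0,0), (0,1), (2,0) is used instead. *)

(** Reduces equality of two three-element multisets of distances to six systems of equations, each
    within reach of [lia]. The nesting is there because the disjunction notation stops at four. *)
Lemma perm_eq3 (T : eqType) (a b c d e f : T) :
  perm_eq [:: a; b; c] [:: d; e; f] ->
  [\/ [/\ a = d, b = e & c = f], [/\ a = d, b = f & c = e],
      [/\ a = e, b = d & c = f] |
      [\/ [/\ a = e, b = f & c = d], [/\ a = f, b = d & c = e]
        | [/\ a = f, b = e & c = d]]].
Proof.
have perm2 (x y z t : T) :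
    perm_eq [:: x; y] [:: z; t] -> x = z /\ y = t \/ x = t /\ y = z.
  move=> p; have := perm_mem p x; rewrite !inE eqxx /= => /esym/orP[]/eqP Dx.
    left; split=> //; move: p; rewrite Dx perm_cons => /perm_small_eq.
    by case/(_ isT).
  right; split=> //; move: p; rewrite Dx perm_sym -(perm_rot 1) /= perm_cons.
  by move/perm_small_eq; case/(_ isT).
move=> p; have := perm_mem p a; rewrite !inE eqxx /= => /esym/or3P[]/eqP Da.
- by move: p; rewrite Da perm_cons => /perm2[][-> ->];
    [constructor 1 | constructor 2].
(* Swapping [d] and [e] puts the match of [a] at the head, where [perm_cons] cancels it. *)
- have q : perm_eq [:: d; e; f] [:: e; d; f].
    by rewrite -[[:: d; e; f]]/([:: d] ++ [:: e] ++ [:: f]) perm_catCA.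
  move: (perm_trans p q); rewrite Da perm_cons => /perm2[][-> ->].
    by constructor 3.
  by constructor 4; constructor 1.
move: p; rewrite Da perm_sym -(perm_rot 2) perm_sym /= perm_cons.
by case/perm2=> -[-> ->]; constructor 4; [constructor 2 | constructor 3].
Qed.

Section MultisetResolving.
Variable G : sgraph.
Implicit Types (s : seq G) (u v : G).

(** A multiset ignores the order of enumeration, so a duplicate-free listing [s] can replace
    [enum]. *)
Lemma m_resolving_seqP s : uniq s ->
  reflect (forall u v, perm_eq [seq dist u w | w <- s] [seq dist v w | w <- s] ->
             u = v)
          (m_resolving [set:: s]).
Proof.
move=> s_uniq; have Ds : perm_eq (enum [set:: s]) s.
  by apply: uniq_perm; rewrite ?enum_uniq // => x; rewrite mem_enum inE.
have r_mE u v : (r_m [set:: s] u == r_m [set:: s] v) =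
    perm_eq [seq dist u w | w <- s] [seq dist v w | w <- s].
  apply/eqP/idP=> [/eq_seq_msetP|] p.
    rewrite -(permPl (perm_map _ Ds)) perm_sym -(permPl (perm_map _ Ds)).
    by rewrite perm_sym.
  apply/eq_seq_msetP; rewrite (permPl (perm_map _ Ds)) perm_sym.
  by rewrite (permPl (perm_map _ Ds)) perm_sym.
apply: (iffP forallP) => [res u v | res u].
  rewrite -r_mE => euv; apply/eqP; apply: contraLR euv => neq_uv.
  by have /forallP/(_ v)/implyP := res u; apply.
apply/forallP=> v; apply/implyP; apply: contraNN.
by rewrite r_mE => /res ->.
Qed.

Lemma md_eq k (W : {set G}) : m_resolving W -> #|W| = k ->
  (forall W' : {set G}, m_resolving W' -> k <= #|W'|) -> md G = Some k.
Proof.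
move=> resW cardW lbk; rewrite /md; case: pickP => [W0 resW0|/(_ W)]; last first.
  by rewrite resW.
case: arg_minnP => // W1 resW1 minW1; congr Some; apply/eqP.
by rewrite eqn_leq lbk // -cardW minW1.
Qed.

(* A function decreasing by at most one along each edge, and by exactly one
   along some edge until [v] is reached, is the distance to [v]. *)
Lemma dist_unique (f : G -> nat) v :
    f v = 0 -> (forall u, f u = 0 -> u = v) ->
    (forall u u', adj u u' -> f u <= (f u').+1) ->
    (forall u, 0 < f u -> exists2 u', adj u u' & (f u').+1 = f u) ->
  forall u, dist u v = f u.
Proof.
move=> fv f0 lip desc u.
have ex_path k : forall u, f u = k ->
    exists p, [/\ path (@adj G) u p, last u p = v & size p = k].
  elim: k => [|k IHk] u' fu'; first by exists [::]; split=> //=; apply: f0.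
  have [|u1 uu1] := desc u'; first by rewrite fu'.
  rewrite fu' => -[/IHk[p [u1p lp sp]]].
  by exists (u1 :: p); rewrite /= uu1 lp sp.
have f_le_size p : forall u, path (@adj G) u p -> last u p = v -> f u <= size p.
  elim: p => [|u1 p IHp] u' /=; first by move=> _ ->; rewrite fv.
  case/andP=> uu1 u1p lp; apply: leq_trans (lip _ _ uu1) _.
  by rewrite ltnS; apply: IHp.
have [p [up lp sp]] := ex_path _ u erefl.
apply/eqP; rewrite eqn_leq -{1}sp dist_le //=.
(* The descending path [p] also gives the connectivity that a shortest path requires. *)
have [|q [uq lq <-]] := @dist_path G u v; last exact: f_le_size.
by apply/connectP; exists p.
Qed.

End MultisetResolving.

Section Grid.
Variables m n : nat.
Local Notation grid := (cart_graph (path_graph m) (path_graph n)).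

(** The absolute difference: subtraction truncates, so one summand is always 0. *)
Definition distn (a b : nat) : nat := (a - b) + (b - a).

Lemma grid_eqP (u v : grid) :
  (u.1 : nat) = v.1 -> (u.2 : nat) = v.2 -> u = v.
Proof.
by case: u v => [u1 u2] [v1 v2] /= e1 e2; congr pair; apply: val_inj.
Qed.

Lemma grid_adjE (u v : grid) :
  adj u v = ((u.1 == v.1 :> nat) && (distn u.2 v.2 == 1)) ||
            ((u.2 == v.2 :> nat) && (distn u.1 v.1 == 1)).
Proof.
rewrite [adj u v]/= /cart_adj -!val_eqE /= /path_adj /distn.
by congr ((_ && _) || (_ && _)); lia.
Qed.

Lemma dist_grid (u v : grid) : dist u v = distn u.1 v.1 + distn u.2 v.2.
Proof.
apply: (dist_unique (f := fun u : grid => distn u.1 v.1 + distn u.2 v.2)).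
- by rewrite /distn; lia.
- by move=> u'; rewrite /distn => e; apply: grid_eqP; lia.
- by move=> x y; rewrite grid_adjE /distn; lia.
move=> [a b]; case: v => [c d].
(* Descent: step the first coordinate towards [c]; once it is there, step the second towards [d]. *)
have [ac|ca|<-] := ltngtP a c => [_|_|].
- have lt : a.+1 < m by have := ltn_ord c; lia.
  by exists (Ordinal lt, b); rewrite ?grid_adjE /distn /=; lia.
- have lt : a.-1 < m by have := ltn_ord a; lia.
  by exists (Ordinal lt, b); rewrite ?grid_adjE /distn /=; lia.
have [bd|db|<-] := ltngtP b d => [_|_|].
- have lt : b.+1 < n by have := ltn_ord d; lia.
  by exists (a, Ordinal lt); rewrite ?grid_adjE /distn /=; lia.
- have lt : b.-1 < n by have := ltn_ord b; lia.
  by exists (a, Ordinal lt); rewrite ?grid_adjE /distn /=; lia.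
by rewrite /distn /=; lia.
Qed.

Lemma ord_neighbour k (i : 'I_k) : 1 < k -> exists j : 'I_k, distn i j = 1.
Proof.
move=> k_gt1; have [i0|i_gt0] := posnP i.
  by exists (Ordinal k_gt1); rewrite i0.
have lt : i.-1 < k by have := ltn_ord i; lia.
by exists (Ordinal lt); rewrite /distn /=; lia.
Qed.

Lemma grid_m_resolving_card (W : {set grid}) :
  1 < m -> 1 < n -> m_resolving W -> 2 < #|W|.
Proof.
move=> m_gt1 n_gt1; rewrite -[W]set_enum -[X in _ < X]/#|_|.
move: (enum W) (enum_uniq W) => s s_uniq /(m_resolving_seqP s_uniq) res.
rewrite cardsE (card_uniqP s_uniq); case: s s_uniq res => [|w1 [|w2 [|//]]] /=.
(* The empty set gives every vertex the empty multiset. *)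
- move=> _ res.
  pose o1 := Ordinal m_gt1; pose o0 := Ordinal (ltnW m_gt1).
  pose b := Ordinal n_gt1.
  by have := res (o0, b) (o1, b) isT => /(congr1 (fun u : grid => val u.1)).
- move=> _ res; case: w1 res => a b res.
  (* One neighbour along each axis; they differ because [a'] is not [a]. *)
  have [a' Da] := ord_neighbour a m_gt1; have [b' Db] := ord_neighbour b n_gt1.
  have /(congr1 (fun u : grid => val u.1)) /= : (a', b) = (a, b') :> grid.
    apply: res; suff -> : dist ((a', b) : grid) (a, b) = dist ((a, b') : grid) (a, b).
      exact: perm_refl.
    by rewrite !dist_grid /=; move: Da Db; rewrite /distn; lia.
  by move: Da; rewrite /distn; lia.
rewrite inE andbT => neq_w res; case/negP: neq_w; apply/eqP/res.
(* Symmetry and the zero diagonal make the two lists transposes of each other. *)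
rewrite (_ : dist w2 w1 = dist w1 w2); last by rewrite !dist_grid /distn; lia.
rewrite (_ : dist w2 w2 = dist w1 w1); last by rewrite !dist_grid /distn; lia.
exact/permPl/(perm_catC [:: _] [:: _]).
Qed.

Lemma grid_m_resolving3 : 2 < m -> 1 < n ->
  exists2 W : {set grid}, m_resolving W & #|W| = 3.
Proof.
move=> m_gt2 n_gt1.
have lt_x0 : 0 < m by lia.
have lt_x1 : 1 < m by lia.
have lt_xl : m.-1 < m by lia.
have lt_y0 : 0 < n by lia.
pose w1 : grid := (Ordinal lt_x0, Ordinal lt_y0).
pose w3 : grid := (Ordinal lt_xl, Ordinal lt_y0).
(* For [m = 3], (1,0) would be the midpoint of [w1] and [w3], and the reflection exchanging them
   would preserve all multisets. *)
pose w2 : grid := if m == 3 then (Ordinal lt_x0, Ordinal n_gt1)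
                  else (Ordinal lt_x1, Ordinal lt_y0).
have s_uniq : uniq [:: w1; w2; w3].
  rewrite /= !inE /w1 /w2 /w3; case: (m =P 3) => m3;
    by rewrite -!pair_eqE /pair_eq -!val_eqE /=; lia.
exists [set:: [:: w1; w2; w3]]; last by rewrite cardsE (card_uniqP s_uniq).
apply/(m_resolving_seqP s_uniq) => -[x y] [x' y'].
(* With these bounds the distance from (x,y) to [w3] is [m.-1 - x + y], without truncation. *)
have := ltn_ord x; have := ltn_ord x'.
move=> lx lx' /= /perm_eq3; rewrite !dist_grid /w1 /w2 /w3 /=.
move=> p; apply: grid_eqP => /=; move: p; case: (m =P 3) => m3 /=; rewrite /distn;
  case=> [[]|[]|[]|[[]|[]|[]]]; lia.
Qed.

End Grid.

Theorem theorem4p2 (m n : nat) (hm : 3 <= m) (hn : 2 <= n) :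
  md (cart_graph (path_graph m) (path_graph n)) = Some 3.
Proof.
have [W resW cardW] := grid_m_resolving3 hm hn.
by apply: md_eq resW cardW _ => W'; apply: grid_m_resolving_card => //; apply: ltnW.
Qed.
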